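(* Let $0<\nu\le\tau^2\le 1/4$ (with $\tau>0$) and let $G$ be a graph on $n$ vertices. If (i) $e(V(G)\setminus B,B)\ge 2\tau^2n^2$ for all $B\subseteq V(G)$ with $\tau n\le|B|\le(1-\tau)n$, and (ii) $|RN_\nu(S')|\ge|S'|+\nu n$ for all $S'\subseteq V(G)$ with $\tau^2n\le|S'|\le(1-\tau^2)n$ and $\Delta(G[S'])<\nu^2n$, then $G$ is a $(\nu^2,\tau)$-robust expander.
   Context: Graphs are finite and simple. For disjoint $A,B\subseteq V(G)$, $e(A,B)$ is the number of edges of $G$ with one endpoint in $A$ and the other in $B$. $\Delta(G[S])$ is the maximum degree of the subgraph induced by $S$. For $v\in V(G)$ and $S\subseteq V(G)$, $d(v,S)=|N(v)\cap S|$. For a graph $G$ on $n$ vertices, $\nu>0$ and $S\subseteq V(G)$, the $\nu$-robust neighborhood of $S$ is $RN_\nu(S)=\{v\in V(G): d(v,S)\ge\nu n\}$. For $0<\nu\le\tau/2$, $G$ is a $(\nu,\tau)$-robust expander if $|RN_\nu(S)|\ge|S|+\nu n$ for all $S\subseteq V(G)$ with $\tau n\le|S|\le(1-\tau)n$. *)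

(* Defs.v *)
From mathcomp Require Import all_boot all_order all_algebra.

Set Implicit Arguments.
Unset Strict Implicit.
Unset Printing Implicit Defensive.

Import Order.TTheory GRing.Theory Num.Theory.
Local Open Scope ring_scope.

(* A finite simple graph is a symmetric irreflexive relation [e] on a finType
   [T]; its number of vertices is [#|T|]. *)

Definition nbhd (T : finType) (e : rel T) (v : T) : {set T} := [set w | e v w].

Definition deg_in (T : finType) (e : rel T) (v : T) (S : {set T}) : nat :=
  #|nbhd e v :&: S|.

(* Edges are unordered pairs [set x; y]; an edge reached from several (x, y)
   is counted once. *)
Definition edges_between (T : finType) (e : rel T) (A B : {set T}) : nat :=
  #|[set [set x; y] | x in A, y in B & e x y]|.

Definition induced (T : finType) (e : rel T) (S : {set T}) :
    rel {x : T | x \in S} :=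
  fun x y => e (val x) (val y).
Arguments induced {T} e S.

(* Equal to 0 on the graph without vertices. *)
Definition max_degree (T : finType) (e : rel T) : nat :=
  (\max_(v : T) #|nbhd e v|)%N.

Definition robust_nbhd (R : realFieldType) (T : finType) (e : rel T) (nu : R)
    (S : {set T}) : {set T} :=
  [set v | nu * #|T|%:R <= (deg_in e v S)%:R].

(* The standing range 0 < nu <= tau / 2 of the parameters is part of the
   notion. *)
Definition robust_expander (R : realFieldType) (T : finType) (e : rel T)
    (nu tau : R) : Prop :=
  0 < nu <= tau / 2 /\
  forall S : {set T},
    tau * #|T|%:R <= #|S|%:R <= (1 - tau) * #|T|%:R ->
    #|S|%:R + nu * #|T|%:R <= #|robust_nbhd e nu S|%:R.

(* Main.v *)
(* Let S1 be the set of vertices of S with fewer than nu^2 n neighbours in S, so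
   that S \ S1 lies in the nu^2-robust neighbourhood RN of S.  If S1 is large,
   its nu-robust neighbourhood has at least |S1| + nu n vertices, all of them
   in RN; counting the edges between S1 and S, at most nu |S1| of them lie in S,
   which leaves a gain of nu (n - |S1|) >= nu^2 n.  If S1 is small, then the many
   edges leaving S force enough vertices of RN outside S. *)
Require Import Defs.
From mathcomp Require Import all_boot all_order all_algebra.
From mathcomp Require Import lra.

Set Implicit Arguments.
Unset Strict Implicit.
Unset Printing Implicit Defensive.

Import Order.TTheory GRing.Theory Num.Theory.
Local Open Scope ring_scope.

Lemma deg_inE (T : finType) (e : rel T) (v : T) (S : {set T}) :
  deg_in e v S = (\sum_(w in S) e v w)%N.
Proof.
rewrite /deg_in -sum1_card [RHS]big_mkcond [LHS]big_mkcond.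
by apply: eq_bigr => w _; rewrite !inE; case: (e v w); case: (w \in S).
Qed.

Lemma deg_in_subset (T : finType) (e : rel T) (v : T) (A B : {set T}) :
  A \subset B -> (deg_in e v A <= deg_in e v B)%N.
Proof. by move=> sAB; apply/subset_leq_card/setIS. Qed.

Lemma deg_in_le_card (T : finType) (e : rel T) (v : T) (S : {set T}) :
  (deg_in e v S <= #|S|)%N.
Proof. exact/subset_leq_card/subsetIr. Qed.

Lemma sum_deg_inC (T : finType) (e : rel T) (A B : {set T}) :
  symmetric e ->
  (\sum_(v in A) deg_in e v B = \sum_(w in B) deg_in e w A)%N.
Proof.
move=> e_sym; under eq_bigr do rewrite deg_inE.
rewrite exchange_big /=; apply: eq_bigr => w _; rewrite deg_inE.
by apply: eq_bigr => v _; rewrite e_sym.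
Qed.

(** Grouping the edges by an endpoint [v] in [A] gives a union bound. Only an inequality holds in
    general, since an edge inside [A :&: B] is one pair but is counted from both ends on the
    right. *)
Lemma edges_between_le_sum_deg_in (T : finType) (e : rel T) (A B : {set T}) :
  (edges_between e A B <= \sum_(v in A) deg_in e v B)%N.
Proof.
apply: (@leq_trans (\sum_(v in A) #|[set [set v; y] | y in B & e v y]|)%N).
  apply: (@leq_trans #|\bigcup_(v in A) [set [set v; y] | y in B & e v y]|).
    apply/subset_leq_card/subsetP => _ /imset2P[v w vA wB ->].
    by apply/bigcupP; exists v => //; apply/imsetP; exists w; rewrite // inE.
  apply: (big_ind2 (fun (X : {set {set T}}) m => #|X| <= m)%N) => //.
    by rewrite cards0.
  move=> X1 m1 X2 m2 le1 le2; apply: leq_trans (leq_add le1 le2).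
  by rewrite cardsU leq_subr.
apply: leq_sum => v _; apply: leq_trans (leq_imset_card _ _) _.
by apply/subset_leq_card/subsetP => w; rewrite !inE andbC.
Qed.

Lemma deg_induced_le (T : finType) (e : rel T) (S : {set T})
    (x : {x : T | x \in S}) :
  (#|nbhd (induced e S) x| <= deg_in e (val x) S)%N.
Proof.
rewrite -(card_imset _ val_inj); apply/subset_leq_card/subsetP => _ /imsetP[y + ->].
by rewrite !inE => exy; rewrite (valP y) andbT.
Qed.

Lemma max_degree_induced_lt (R : realFieldType) (T : finType) (e : rel T)
    (S : {set T}) (x : R) :
  0 < x -> (forall v, v \in S -> (deg_in e v S)%:R < x) ->
  (max_degree (induced e S))%:R < x.
Proof.
(* The maximum starts from the default value 0, so [0 < x] is the base case; it settles empty
   [S]. *)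
move=> x_gt0 deg_lt; apply: (big_ind (fun m : nat => m%:R < x)) => //.
  by move=> m1 m2 lt1 lt2; rewrite /maxn; case: ifP.
move=> v _; apply: le_lt_trans (deg_lt _ (valP v)).
by rewrite ler_nat deg_induced_le.
Qed.

Lemma robust_nbhd_subset (R : realFieldType) (T : finType) (e : rel T)
    (mu nu : R) (A B : {set T}) :
  mu <= nu -> A \subset B -> robust_nbhd e nu A \subset robust_nbhd e mu B.
Proof.
move=> le_mu sAB; apply/subsetP => v; rewrite !inE => hv.
apply: le_trans (le_trans hv _); first by rewrite ler_wpM2r ?ler0n.
by rewrite ler_nat deg_in_subset.
Qed.

(** Double counting of adjacent pairs between [A] and [W], the part of the robust neighbourhood in
    [B]: each vertex of [W] lies in at least [nu * #|T|] pairs, each vertex of [A] in at most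
    [c]. *)
Lemma card_robust_nbhd_in_le (R : realFieldType) (T : finType) (e : rel T)
    (nu c : R) (A B : {set T}) :
  symmetric e -> (forall v, v \in A -> (deg_in e v B)%:R <= c) ->
  #|robust_nbhd e nu A :&: B|%:R * (nu * #|T|%:R) <= #|A|%:R * c.
Proof.
move=> e_sym deg_le; set W := _ :&: B.
apply: (@le_trans _ _ (\sum_(v in W) deg_in e v A)%:R).
  rewrite natr_sum mulr_natl -sumr_const; apply: ler_sum => v.
  by rewrite !inE => /andP[].
rewrite sum_deg_inC // natr_sum mulr_natl -sumr_const; apply: ler_sum => v vA.
apply: le_trans (deg_le v vA); rewrite ler_nat deg_in_subset //.
exact: subsetIr.
Qed.

(** A vertex of [A] sends at most [#|B|] edges to [B] if it is in the robust neighbourhood, and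
    fewer than [nu * #|T|] otherwise. *)
Lemma edges_between_le_robust_nbhd (R : realFieldType) (T : finType)
    (e : rel T) (nu : R) (A B : {set T}) :
  0 <= nu ->
  (edges_between e A B)%:R <=
    #|robust_nbhd e nu B :&: A|%:R * #|B|%:R + #|A|%:R * (nu * #|T|%:R).
Proof.
move=> nu_ge0; set W := robust_nbhd e nu B.
apply: (@le_trans _ _ (\sum_(v in A) deg_in e v B)%:R).
  by rewrite ler_nat edges_between_le_sum_deg_in.
rewrite natr_sum (big_setID W) /= setIC lerD //.
  rewrite mulr_natl -sumr_const; apply: ler_sum => v _.
  by rewrite ler_nat deg_in_le_card.
apply: (@le_trans _ _ (#|A :\: W|%:R * (nu * #|T|%:R))).
  rewrite mulr_natl -sumr_const; apply: ler_sum => v.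
  by rewrite !inE -ltNge => /andP[/ltW].
rewrite ler_wpM2r ?mulr_ge0 ?ler0n // ler_nat.
exact/subset_leq_card/subsetDl.
Qed.

Theorem lemma4p3 (R : realFieldType) (T : finType) (e : rel T) (nu tau : R)
    (e_sym : symmetric e) (e_irr : irreflexive e)
    (nu_gt0 : 0 < nu) (tau_gt0 : 0 < tau)
    (nu_le : nu <= tau ^+ 2) (tau_le : tau ^+ 2 <= 1 / 4)
    (cuts : forall B : {set T},
       tau * #|T|%:R <= #|B|%:R <= (1 - tau) * #|T|%:R ->
       2 * tau ^+ 2 * #|T|%:R ^+ 2 <= (edges_between e (~: B) B)%:R)
    (sparse : forall S' : {set T},
       tau ^+ 2 * #|T|%:R <= #|S'|%:R <= (1 - tau ^+ 2) * #|T|%:R ->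
       (max_degree (induced e S'))%:R < nu ^+ 2 * #|T|%:R ->
       #|S'|%:R + nu * #|T|%:R <= #|robust_nbhd e nu S'|%:R) :
  robust_expander e (nu ^+ 2) tau.
Proof.
have tau_le2 : tau <= 1 / 2 by nra.
have tau2_le : tau ^+ 2 <= tau / 2 by nra.
have nu_le_tau : nu <= tau / 2 by lra.
have nu2_le : nu ^+ 2 <= nu / 4 by nra.
have nu2_gt0 : 0 < nu ^+ 2 by rewrite exprn_gt0.
split=> [|S /[dup] S_range /andP[S_ge S_le]]; first by rewrite nu2_gt0 /=; lra.
have [T0 | T_gt0] := posnP #|T|.
  have -> : #|S| = 0%N by apply/eqP; rewrite -leqn0 -T0 max_card.
  by rewrite T0 mulr0 add0r ler0n.
set n : R := #|T|%:R in sparse cuts S_range S_ge S_le *.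
have n_gt0 : 0 < n by rewrite ltr0n.
set RN := robust_nbhd e (nu ^+ 2) S.
pose S1 := S :\: RN.
have S1_sub : S1 \subset S := subsetDl _ _.
have S1_deg v : v \in S1 -> (deg_in e v S)%:R < nu ^+ 2 * n.
  by rewrite !inE -ltNge => /andP[].
have S1_le : #|S1|%:R <= #|S|%:R :> R by rewrite ler_nat subset_leq_card.
have cardS : #|S|%:R = #|RN :&: S|%:R + #|S1|%:R :> R.
  by rewrite -natrD setIC cardsID.
have cardRN : #|RN|%:R = #|RN :&: S|%:R + #|RN :\: S|%:R :> R.
  by rewrite -natrD cardsID.
have [S1_big | S1_small] := leP (tau ^+ 2 * n) #|S1|%:R.
  have {sparse} : #|S1|%:R + nu * n <= #|robust_nbhd e nu S1|%:R.
    apply: sparse; first by rewrite S1_big /=; nra.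
    apply: max_degree_induced_lt => [|v vS1]; first exact: mulr_gt0.
    apply: le_lt_trans (S1_deg v vS1); rewrite ler_nat.
    exact: deg_in_subset.
  set RN1 := robust_nbhd e nu S1.
  rewrite -(cardsID S RN1) natrD => RN1_ge.
  have RN1_out : #|RN1 :\: S|%:R <= #|RN :\: S|%:R :> R.
    rewrite ler_nat; apply/subset_leq_card/setSD/robust_nbhd_subset => //.
    by lra.
  (* Double counting with [c = nu ^+ 2 * n], then cancellation of [nu * n]. *)
  have RN1_in : #|RN1 :&: S|%:R <= nu * #|S1|%:R.
    have := card_robust_nbhd_in_le nu e_sym (fun v vS1 => ltW (S1_deg v vS1)).
    rewrite -/n -/RN1 => le_in; rewrite -(ler_pM2r (mulr_gt0 nu_gt0 n_gt0)).
    by apply: le_trans le_in _; rewrite expr2; lra.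
  (* As [nu <= tau], the bound on [#|S|] gives [#|S1| <= (1 - nu) * n], so the surplus
     [nu * n - nu * #|S1|] is at least [nu ^+ 2 * n]. *)
  have : nu * #|S1|%:R <= nu * ((1 - nu) * n).
    by rewrite ler_pM2l //; nra.
  lra.
have /le_trans/(_ (edges_between_le_robust_nbhd e _ _ (ltW nu2_gt0))) :=
  cuts S S_range.
rewrite -/n -/RN -setDE => edges_le.
have cardC : #|~: S|%:R = n - #|S|%:R :> R.
  by rewrite /n -(cardsC S) natrD addrC addKr.
have S_gt0 : 0 < #|S|%:R :> R by apply: lt_le_trans S_ge; exact: mulr_gt0.
(* The common part [RN :&: S] cancels from [cardS] and [cardRN]. *)
suff : #|S1|%:R + nu ^+ 2 * n <= #|RN :\: S|%:R by lra.
(* After multiplication by [#|S|], the terms [nu ^+ 2 * n * #|S|] cancel against [edges_le]. One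
   half of the cut bound [2 * tau ^+ 2 * n ^+ 2] then pays for [#|S1| * #|S|] ([h1]), the other for
   [nu ^+ 2 * n ^+ 2] ([h2]). *)
rewrite -(ler_pM2r S_gt0).
move: edges_le; rewrite cardC => edges_le.
have S_le_n : #|S|%:R <= n by nra.
have h1 : #|S1|%:R * #|S|%:R <= tau ^+ 2 * n * n.
  by apply: ler_pM => //; rewrite ?ler0n // ltW.
have h2 : nu ^+ 2 * n * n <= tau ^+ 2 * n * n.
  by rewrite !ler_pM2r //; lra.
by move: edges_le h1 h2; rewrite !expr2; lra.
Qed.
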